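(* Let $n\ge2$, let $M=(m_{kl})\in\mathbb{R}^{n\times n}$ be positive definite, and suppose that the ellipsoid $$\mathcal{E}_M=\{x\in\mathbb{R}^n:\ x^\top Mx=n\}$$ meets every branch of the hypersurface $|p(x)|=1$, where $p(x)=\prod_{j=1}^n x_j$ for $x=(x_1,\ldots,x_n)\in\mathbb{R}^n$. Then $$\sum_{k=1}^n\frac{1}{m_{kk}}\ge n.$$ Consequently, $$\mathrm{tr}(M^{-1})\ge n.$$ Moreover, equality holds if and only if $M=I_n$.
   Context: Here $I_n$ is the $n\times n$ identity matrix and $\mathrm{tr}$ denotes the trace. The hypersurface $\{x\in\mathbb{R}^n:|p(x)|=1\}$ has $2^n$ branches (connected components), one in each open orthant of $\mathbb{R}^n$. Thus the hypothesis says that for every sign vector $\varepsilon\in\{-1,1\}^n$ there is a point $x\in\mathcal{E}_M$ with $\varepsilon_jx_j>0$ for all $j$ and $|p(x)|=1$. *)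

(* Defs.v *)
From HB Require Import structures.
From mathcomp Require Import all_boot all_order all_algebra.
From mathcomp Require Import all_classical all_reals all_analysis.

Set Implicit Arguments.
Unset Strict Implicit.
Unset Printing Implicit Defensive.

Import Order.TTheory GRing.Theory Num.Theory.
Import numFieldNormedType.Exports.

Local Open Scope classical_set_scope.
Local Open Scope ring_scope.

(* Symmetry is part of positive definiteness; the quadratic form alone only
   sees the symmetric part of M. *)
Definition posdefmx (R : realType) (n : nat) (M : 'M[R]_n) : Prop :=
  M^T = M /\ forall x : 'cV[R]_n, x != 0 -> 0 < (x^T *m M *m x) 0 0.

Definition ellipsoid (R : realType) (n : nat) (M : 'M[R]_n) : set 'cV[R]_n :=
  [set x | (x^T *m M *m x) 0 0 = n%:R].

Definition coord_prod (R : realType) (n : nat) (x : 'cV[R]_n) : R :=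
  \prod_(j < n) x j 0.

Definition unit_hypersurface (R : realType) (n : nat) : set 'cV[R]_n :=
  [set x | `|coord_prod x| = 1].

Definition is_branch (R : realType) (n : nat) (B : set 'cV[R]_n) : Prop :=
  exists2 x, unit_hypersurface x & B = connected_component (@unit_hypersurface R n) x.

Definition meets_every_branch (R : realType) (n : nat) (E : set 'cV[R]_n) : Prop :=
  forall B : set 'cV[R]_n, is_branch B -> E `&` B !=set0.

Lemma unit_hypersurface_neq0 (R : realType) (n : nat) (x : 'cV[R]_n) (j : 'I_n) :
  unit_hypersurface x -> x j 0 != 0.
Proof.
move=> Sx; apply/eqP => xj0; move: Sx.
rewrite /unit_hypersurface /= /coord_prod (bigD1 j) //= xj0 mul0r normr0.
by move/esym/eqP; rewrite oner_eq0.
Qed.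

Lemma branch_same_sign (R : realType) (n : nat) (x y : 'cV[R]_n) (j : 'I_n) :
  connected_component (@unit_hypersurface R n) x y -> 0 < x j 0 * y j 0.
Proof.
move=> [C [Cx CS Cc] Cy].
pose f (z : 'cV[R]_n) : R := z j 0.
have : connected (f @` C).
  apply: connected_continuous_connected => //.
  by apply: continuous_subspaceT => z; exact: coord_continuous.
move/connected_intervalP => fC.
have fC0 : ~ (f @` C) 0.
  by move=> [z Cz fz]; move: (unit_hypersurface_neq0 j (CS _ Cz)); rewrite -/(f z) fz eqxx.
have fx : (f @` C) (x j 0) by exists x.
have fy : (f @` C) (y j 0) by exists y.
rewrite ltNge; apply/negP => xy0; apply: fC0.
have [x0|x0] := lerP (x j 0) 0.
  have [y0|y0] := lerP (y j 0) 0.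
    have xn := unit_hypersurface_neq0 j (CS _ Cx).
    have yn := unit_hypersurface_neq0 j (CS _ Cy).
    have x0' : x j 0 < 0 by rewrite lt_neqAle xn.
    have y0' : y j 0 < 0 by rewrite lt_neqAle yn.
    by move: xy0; rewrite leNgt nmulr_rgt0 // y0'.
  by apply: (fC _ _ fx fy); rewrite x0 ltW.
apply: (fC _ _ fy fx); rewrite (ltW x0) andbT.
by rewrite -(pmulr_rle0 _ x0).
Qed.

Lemma same_sign_branch (R : realType) (n : nat) (x y : 'cV[R]_n) :
  unit_hypersurface x -> unit_hypersurface y ->
  (forall j, 0 < x j 0 * y j 0) ->
  connected_component (@unit_hypersurface R n) x y.
Proof.
move=> Sx Sy xy.
have q0 j : 0 < y j 0 / x j 0.
  have xn := unit_hypersurface_neq0 j Sx.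
  have -> : y j 0 / x j 0 = (x j 0 * y j 0) / (x j 0 * x j 0).
    by rewrite invfM mulrACA divff // mul1r.
  by rewrite divr_gt0 // lt_neqAle eq_sym mulf_neq0 //= -expr2 sqr_ge0.
pose g (t : R) : 'cV[R]_n := \col_j (x j 0 * expR (t * ln (y j 0 / x j 0))).
have g0 : g 0 = x by apply/colP => j; rewrite mxE mul0r expR0 mulr1.
have g1 : g 1 = y.
  apply/colP => j; rewrite mxE mul1r lnK ?posrE // mulrCA divff ?mulr1 //.
  exact: unit_hypersurface_neq0.
have gS t : unit_hypersurface (g t).
  have prodE s : coord_prod (g s) =
      coord_prod x * expR (s * \sum_j ln (y j 0 / x j 0)).
    rewrite /coord_prod mulr_sumr expR_sum -big_split /=.
    by apply: eq_bigr => j _; rewrite mxE.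
  have s0 : \sum_j ln (y j 0 / x j 0) = 0.
    apply: expR_inj; rewrite expR0.
    have : `|coord_prod (g 1)| = 1 by rewrite g1.
    by rewrite prodE normrM Sx !mul1r ger0_norm ?expR_ge0.
  by rewrite /unit_hypersurface /= prodE s0 mulr0 expR0 mulr1.
have gc : continuous g.
  move=> t; apply/cvg_ballP => e e0.
  pose f (j : 'I_n) (s : R) := x j 0 * expR (s * ln (y j 0 / x j 0)).
  have fc j : f j s @[s --> t] --> f j t.
    have lc : s * ln (y j 0 / x j 0) @[s --> t] --> t * ln (y j 0 / x j 0).
      by apply: cvgMr_tmp; exact: cvg_id.
    have ec := cvg_comp _ _ lc (@continuous_expR R _).
    exact: cvgM (cvg_cst _) ec.
  have : \forall s \near t, forall j, ball (f j t) e (f j s).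
    apply: (@filter_forall R 'I_n (fun j s => ball (f j t) e (f j s)) (nbhs t)).
    by move=> j; have /cvg_ballP := fc j; exact.
  by apply: filterS => s h; split => // i j; rewrite !mxE; exact: h.
exists (g @` `[0, 1]).
  split; first by exists 0 => //=; rewrite in_itv /= lexx ler01.
    by move=> _ [t _ <-].
  apply: connected_continuous_connected; first exact: segment_connected.
  exact: continuous_subspaceT.
by exists 1 => //=; rewrite in_itv /= lexx ler01.
Qed.

(* The branches are the pieces of the hypersurface in the 2 ^ n open orthants. *)
Lemma meets_every_branchP (R : realType) (n : nat) (E : set 'cV[R]_n) :
  meets_every_branch E <->
  forall eps : 'I_n -> R, (forall j, eps j = 1 \/ eps j = -1) ->
    exists x, [/\ E x, forall j, 0 < eps j * x j 0 & `|coord_prod x| = 1].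
Proof.
split=> [H eps epsP|H _ [x Sx ->]].
  have Se : unit_hypersurface (\col_j eps j).
    rewrite /unit_hypersurface /= /coord_prod normr_prod big1 // => j _.
    by rewrite mxE; case: (epsP j) => ->; rewrite ?normrN normr1.
  have [y [Ey xy]] := H _ (ex_intro2 _ _ _ Se erefl).
  exists y; split => //; last exact: (connected_component_sub xy).
  by move=> j; have := branch_same_sign j xy; rewrite mxE.
have [j|y [Ey xy Sy]] := H (fun j => Num.sg (x j 0)).
  have := unit_hypersurface_neq0 j Sx.
  by case: sgrP => // _ _; [left|right].
exists y; split => //; apply: same_sign_branch => // j.
by rewrite [x j 0]numEsg mulrAC mulr_gt0 // normr_gt0; exact: unit_hypersurface_neq0.
Qed.

(* Main.v *)
Require Import Defs.
From mathcomp Require Import all_boot all_order all_fingroup all_algebra.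
From mathcomp Require Import all_classical all_reals all_analysis.
From mathcomp Require Import ring lra.

(** In each of the 2 ^ n open orthants, p attains a maximum of its absolute value
    on the part of the ellipsoid in that orthant, at a point x_s with
    x_k (M x)_k = 1 for all k ([exists_inverse_eigenvector]). As the ellipsoid
    meets the branch |p| = 1 in that orthant, |p(x_s)| >= 1, and AM-GM gives
    |x_s|^2 >= n.

    These 2 ^ n points solve a system of n quadratic equations, and that makes a
    weighted average of |x_s|^2 computable. For solutions x and u put
    C(x, u) = diag(1/x) + diag(u) M. Then C(x, u) (x - u) = 0, so
    \det C(x_s, x_t) = 0 for s <> t. Expanding this determinant along the
    diagonal writes the 2 ^ n by 2 ^ n matrix of its values as a product A B, the
    inner index running over the subsets of the coordinates. Since A B is
    diagonal and invertible, the factors may be exchanged, and each diagonal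
    entry of the exchanged product is a summation identity over the points
    ([sum_det_crossmx]). With the positive weights
    w_s = 1 / \det (1 + X_s M X_s), X_s = diag(x_s), two of these identities say
      \sum_s w_s = 1   and   \sum_s w_s (x_s)_k^2 = 1 / m_kk.
    Hence \sum_k 1 / m_kk is an average of the numbers |x_s|^2 >= n, which is the
    first inequality; the second follows from 1 / m_kk <= (M^-1)_kk, an instance
    of Cauchy-Schwarz ([inv_diag_le]).

    If the sum equals n, then |x_s|^2 = n for every s because all weights are
    positive. The equality case of AM-GM makes x_s a vector of signs, so
    M x_s = 1 / x_s = x_s for every sign vector, and M is the identity. *)

Import Order.TTheory GRing.Theory Num.Theory.
Import numFieldNormedType.Exports.
Local Open Scope ring_scope.

(** * Multilinear expansion of a determinant along the diagonal *)

(** [mulmx1C] transported along [enum_val], so that subsets of 'I_n can index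
    rows and columns directly. *)
Lemma sum_inverseC {R : comUnitRingType} {T : finType} (A B : T -> T -> R) :
  (forall s t, \sum_u A s u * B u t = (s == t)%:R) ->
  forall s t, \sum_u B s u * A u t = (s == t)%:R.
Proof.
move=> AB s t.
pose mx (C : T -> T -> R) : 'M[R]_(#|T|) := \matrix_(i, j) C (enum_val i) (enum_val j).
have mxM C D i j :
    (mx C *m mx D) i j = \sum_u C (enum_val i) u * D u (enum_val j).
  rewrite mxE (big_enum_val (fun u => C (enum_val i) u * D u (enum_val j))) /=.
  by apply: eq_bigr => k _; rewrite !mxE.
have /mulmx1C/matrixP BA : mx A *m mx B = 1%:M.
  by apply/matrixP => i j; rewrite mxM AB mxE (inj_eq enum_val_inj).
have := BA (enum_rank s) (enum_rank t).
by rewrite mxM !mxE !enum_rankK (inj_eq enum_rank_inj).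
Qed.

(** The coefficient of the monomial \prod_(k in S) d_k in \det (diag d + N):
    the principal minor of N on the complement of S, written as a full-size
    determinant so that the rows in S need no deletion. *)
Definition diag_coef {R : comNzRingType} {n} (N : 'M[R]_n) (S : {set 'I_n}) : R :=
  \det (\matrix_(i, j) if i \in S then (i == j)%:R else N i j).

Lemma det_diag_add {R : comNzRingType} {n} (d : 'rV[R]_n) (N : 'M[R]_n) :
  \det (diag_mx d + N) = \sum_(S : {set 'I_n}) (\prod_(k in S) d 0 k) * diag_coef N S.
Proof.
under [RHS]eq_bigr do rewrite mulr_sumr.
rewrite exchange_big /=; apply: eq_bigr => s _.
under eq_bigr do rewrite mxE.
rewrite bigA_distr mulr_sumr; apply: eq_bigr => S _.
rewrite mulrCA; congr (_ * _); rewrite [X in X * _]big_mkcond -big_split /=.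
apply: eq_bigr => i _; rewrite !mxE.
by case: (i \in S); rewrite ?mul1r // mulr_natr.
Qed.

Lemma diag_coefT {R : comNzRingType} {n} (N : 'M[R]_n) : diag_coef N [set: 'I_n]%SET = 1.
Proof.
by rewrite -(@det1 R n); congr (\det _); apply/matrixP => i j; rewrite !mxE finset.in_setT.
Qed.

(** Only the identity contributes to the Leibniz formula: a permutation that
    fixes every index other than k also fixes k. *)
Lemma diag_coefC1 {R : comNzRingType} {n} (N : 'M[R]_n) (k : 'I_n) :
  diag_coef N [set~ k]%SET = N k k.
Proof.
rewrite /diag_coef /determinant (bigD1 (1%g : 'S_n)) //= [X in _ + X]big1 ?addr0.
  rewrite odd_perm1 expr0 mul1r (bigD1 k) //= [X in _ * X]big1 ?mulr1.
    by rewrite !mxE perm1 !inE eqxx.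
  by move=> i ik; rewrite !mxE perm1 !inE ik eqxx.
move=> s; have [fix_s|] := boolP [forall (i | i != k), s i == i].
  case/eqP; apply/permP => i; rewrite perm1.
  have [->|/(forall_inP fix_s)/eqP//] := eqVneq i k.
  apply/eqP; apply: contraTT fix_s => skk; apply/forall_inPn; exists (s k) => //.
  by rewrite (inj_eq perm_inj).
case/forall_inPn => i; rewrite unfold_in => ik si _.
by rewrite (bigD1 i) //= !mxE !inE ik eq_sym (negPf si) mul0r mulr0.
Qed.

(** * Inverse eigenvectors and their interpolation identity *)

(** The matrix C(x, u) for which the difference of the quadratic systems
    f_k(v) = v_k (M v)_k - 1 at x and u reads f(x) - f(u) = C(x, u) (x - u),
    once (M x)_k has been replaced by 1 / x_k. At u = x it is the Jacobian
    matrix of f. *)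
Definition crossmx {F : fieldType} {n} (M : 'M[F]_n) (x u : 'cV[F]_n) : 'M[F]_n :=
  diag_mx (\row_k (x k 0)^-1) + diag_mx u^T *m M.

(** For symmetric invertible M, these are the critical points of \prod_k v_k on
    v^T M v = n that lie off the coordinate hyperplanes. *)
Definition inverse_eigenvector {F : fieldType} {n} (M : 'M[F]_n) (x : 'cV[F]_n) :=
  forall k, x k 0 * (M *m x) k 0 = 1.

Lemma inverse_eigenvector_neq0 {F : fieldType} {n} {M : 'M[F]_n} {x : 'cV[F]_n} k :
  inverse_eigenvector M x -> x k 0 != 0.
Proof. by move/(_ k); apply: contra_eq_neq => ->; rewrite mul0r eq_sym oner_neq0. Qed.

Lemma inverse_eigenvectorE {F : fieldType} {n} {M : 'M[F]_n} {x : 'cV[F]_n} k :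
  inverse_eigenvector M x -> (M *m x) k 0 = (x k 0)^-1.
Proof.
move=> hx; have x0 := inverse_eigenvector_neq0 k hx.
by apply: (mulfI x0); rewrite hx divff.
Qed.

(** Both points solve the same system, so the nonzero vector x - u lies in the
    kernel of C(x, u). *)
Lemma det_crossmx_eq0 {F : fieldType} {n} (M : 'M[F]_n) (x u : 'cV[F]_n) :
  inverse_eigenvector M x -> inverse_eigenvector M u -> x != u ->
  \det (crossmx M x u) = 0.
Proof.
move=> hx hu; apply: contra_neq_eq; rewrite -unitfE -[_ \in _]/(_ \in unitmx) => Cu.
apply/eqP; rewrite -subr_eq0 -[x - u](mulKmx Cu); apply/eqP.
suff -> : crossmx M x u *m (x - u) = 0 by rewrite mulmx0.
apply/colP => k; rewrite mulmxDl -mulmxA !mul_diag_mx mulmxBr.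
have x0 := inverse_eigenvector_neq0 k hx.
have := inverse_eigenvectorE k hx; have := inverse_eigenvectorE k hu.
move: (M *m u) (M *m x) => v y vk yk; rewrite !mxE vk yk.
by field; rewrite x0 (inverse_eigenvector_neq0 k hu).
Qed.

(** Expanding \det C(x s, x t) over subsets factors it as a matrix product: a
    monomial in 1 / x s times a coefficient that depends on x t alone. By
    [det_crossmx_eq0] the product is diagonal, so the second factor, scaled by
    the Jacobians, is a right inverse of the first. It is then also a left
    inverse, because there are as many points as subsets, namely 2 ^ n; the
    claim is the diagonal entry S of that left-inverse identity. *)
Lemma sum_det_crossmx {F : fieldType} {n} (M : 'M[F]_n) (x : {set 'I_n} -> 'cV[F]_n) :
  injective x -> (forall s, inverse_eigenvector M (x s)) ->
  (forall s, \det (crossmx M (x s) (x s)) != 0) ->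
  forall S : {set 'I_n},
  \sum_s (\prod_(k in S) (x s k 0)^-1) * diag_coef (diag_mx (x s)^T *m M) S
         / \det (crossmx M (x s) (x s)) = 1.
Proof.
move=> xI hx J0 S.
pose A s (S : {set 'I_n}) := \prod_(k in S) (x s k 0)^-1.
pose B (S : {set 'I_n}) t :=
  diag_coef (diag_mx (x t)^T *m M) S / \det (crossmx M (x t) (x t)).
have /sum_inverseC/(_ S S) : forall s t, \sum_u A s u * B u t = (s == t)%:R.
  move=> s t; under eq_bigr do rewrite mulrA.
  rewrite -mulr_suml; set d := (X in X / _).
  have -> : d = \det (crossmx M (x s) (x t)).
    rewrite det_diag_add; apply: eq_bigr => U _; congr (_ * _).
    by apply: eq_bigr => k _; rewrite mxE.
  have [->|st] := eqVneq s t; first by rewrite divff.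
  by rewrite det_crossmx_eq0 ?mul0r // (inj_eq xI).
rewrite eqxx => BA; apply: (etrans _ BA); apply: eq_bigr => s _.
by rewrite /A /B [RHS]mulrC mulrA.
Qed.

(** For symmetric positive definite M this is 1 / \det (1 + X M X) with
    X = diag x, hence positive; see [weight_gt0]. *)
Definition weight {F : fieldType} {n} (M : 'M[F]_n) (x : 'cV[F]_n) : F :=
  \prod_k (x k 0)^-1 / \det (crossmx M x x).

Lemma sum_weight {F : fieldType} {n} (M : 'M[F]_n) (x : {set 'I_n} -> 'cV[F]_n) :
  injective x -> (forall s, inverse_eigenvector M (x s)) ->
  (forall s, \det (crossmx M (x s) (x s)) != 0) ->
  \sum_s weight M (x s) = 1.
Proof.
move=> xI hx J0; rewrite -(sum_det_crossmx _ _ xI hx J0 [set: 'I_n]%SET).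
apply: eq_bigr => s _; rewrite diag_coefT mulr1.
by congr (_ / _); apply: eq_bigl => k; rewrite inE.
Qed.

(** The second moments of the weights: dropping k from S = setT trades the
    factor 1 / x_k for x_k * M k k. *)
Lemma sum_weight_sqr {F : fieldType} {n} (M : 'M[F]_n) (x : {set 'I_n} -> 'cV[F]_n) k :
  injective x -> (forall s, inverse_eigenvector M (x s)) ->
  (forall s, \det (crossmx M (x s) (x s)) != 0) -> M k k != 0 ->
  \sum_s weight M (x s) * x s k 0 ^+ 2 = (M k k)^-1.
Proof.
move=> xI hx J0 Mk; apply: (mulIf Mk); rewrite mulVf // mulr_suml.
rewrite -(sum_det_crossmx _ _ xI hx J0 [set~ k]%SET); apply: eq_bigr => s _.
rewrite diag_coefC1 mul_diag_mx !mxE /weight (bigD1 k) //=.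
rewrite [in RHS](eq_bigl (fun i => i != k)) => [|i]; last by rewrite !inE.
have := J0 s; have := inverse_eigenvector_neq0 k (hx s) => x0 d0.
by field; rewrite d0.
Qed.

(** * Positive definite matrices *)

Definition bform {R : comNzRingType} {n} (M : 'M[R]_n) (x y : 'cV[R]_n) : R :=
  (x^T *m M *m y) 0 0.

Lemma bformE {R : comNzRingType} {n} (M : 'M[R]_n) x y :
  bform M x y = \sum_i x i 0 * (M *m y) i 0.
Proof. by rewrite /bform -mulmxA mxE; apply: eq_bigr => i _; rewrite mxE. Qed.

Lemma bformDr {R : comNzRingType} {n} (M : 'M[R]_n) x y z :
  bform M x (y + z) = bform M x y + bform M x z.
Proof. by rewrite /bform mulmxDr mxE. Qed.

Lemma bformZr {R : comNzRingType} {n} (M : 'M[R]_n) a x y :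
  bform M x (a *: y) = a * bform M x y.
Proof. by rewrite /bform -scalemxAr mxE. Qed.

Lemma bform_delta {R : comNzRingType} {n} (M : 'M[R]_n) k y :
  bform M (delta_mx k 0) y = (M *m y) k 0.
Proof. by rewrite /bform trmx_delta -mulmxA -rowE mxE. Qed.

Lemma bform_deltakk {R : comNzRingType} {n} (M : 'M[R]_n) k :
  bform M (delta_mx k 0) (delta_mx k 0) = M k k.
Proof. by rewrite bform_delta -colE mxE. Qed.

Section PosDef.
Local Open Scope classical_set_scope.
Local Open Scope ring_scope.
Context {R : realType} {n : nat}.
Implicit Types (M N : 'M[R]_n) (x y : 'cV[R]_n).

Lemma bformC M x y : posdefmx M -> bform M x y = bform M y x.
Proof.
case=> MT _; rewrite /bform -[in RHS](trmxK (y^T *m M *m x)) [RHS]mxE.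
by rewrite !trmx_mul trmxK MT mulmxA.
Qed.

Lemma bform_gt0 M x : posdefmx M -> x != 0 -> 0 < bform M x x.
Proof. by case=> _; apply. Qed.

(** The form is nonnegative at (y, y)_M x - (x, y)_M y. *)
Lemma bform_CauchySchwarz M x y : posdefmx M ->
  bform M x y ^+ 2 <= bform M x x * bform M y y.
Proof.
move=> hM; have [->|y0] := eqVneq y 0.
  by rewrite /bform !mulmx0 !mxE expr0n mulr0.
have y1 := bform_gt0 _ _ hM y0; set a := bform M y y in y1 *.
pose z := a *: x + (- bform M x y) *: y.
have : 0 <= bform M z z.
  have [->|/(bform_gt0 _ _ hM)/ltW//] := eqVneq z 0.
  by rewrite /bform mulmx0 mxE.
have -> : bform M z z = a * (bform M x x * a - bform M x y ^+ 2).
  rewrite {2}/z bformDr !bformZr !(bformC _ z) // /z !bformDr !bformZr.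
  by rewrite (bformC _ y x) // -/a; ring.
by rewrite pmulr_rge0 // subr_ge0.
Qed.

Lemma posdef_diag_gt0 M k : posdefmx M -> 0 < M k k.
Proof.
move=> hM; rewrite -bform_deltakk; apply: bform_gt0 => //.
by apply/eqP => /matrixP/(_ k 0); rewrite !mxE !eqxx => /eqP; rewrite oner_eq0.
Qed.

Lemma posdef_unitmx M : posdefmx M -> M \in unitmx.
Proof.
move=> hM; rewrite unitmxE unitfE; apply/det0P => -[v v0 vM].
have : 0 < bform M v^T v^T by apply: bform_gt0; rewrite // -trmx0 (inj_eq trmx_inj).
by rewrite /bform trmxK vM mul0mx mxE ltxx.
Qed.

Lemma posdefD M N : posdefmx M -> posdefmx N -> posdefmx (M + N).
Proof.
move=> [MT M0] [NT N0]; split=> [|x x0]; first by rewrite linearD /= MT NT.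
by rewrite mulmxDr mulmxDl mxE addr_gt0 ?M0 ?N0.
Qed.

Lemma posdefZ a M : 0 < a -> posdefmx M -> posdefmx (a *: M).
Proof.
move=> a0 [MT M0]; split=> [|x x0]; first by rewrite linearZ /= MT.
by rewrite -scalemxAr -scalemxAl mxE mulr_gt0 ?M0.
Qed.

Lemma posdef_diag_mx (d : 'rV[R]_n) : (forall k, 0 < d 0 k) -> posdefmx (diag_mx d).
Proof.
move=> d0; split=> [|x x0]; first exact: tr_diag_mx.
rewrite -/(bform _ x x) bformE lt_neqAle.
have t0 k : 0 <= x k 0 * (diag_mx d *m x) k 0.
  by rewrite mul_diag_mx mxE mulrCA mulr_ge0 ?(ltW (d0 k)) // -expr2 sqr_ge0.
rewrite sumr_ge0 // andbT eq_sym; apply: contra x0.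
rewrite psumr_eq0 // => /allP x0; apply/eqP/colP => k.
have := x0 k (mem_index_enum _); rewrite mul_diag_mx mxE mulrCA -expr2.
by rewrite mulf_eq0 (gt_eqF (d0 k)) sqrf_eq0 mxE => /eqP.
Qed.

Lemma posdef1 : posdefmx (1%:M : 'M[R]_n).
Proof. by rewrite -diag_const_mx; apply: posdef_diag_mx => k; rewrite mxE ltr01. Qed.

(** The determinant does not vanish on the segment from M to the identity, where
    it ends at 1; as a polynomial in the parameter it cannot change sign. *)
Lemma posdef_det_gt0 M : posdefmx M -> 0 < \det M.
Proof.
move=> hM; rewrite ltNge; apply/negP => dM.
pose p : {poly R} := \det (\matrix_(i, j) ((1 - 'X) * (M i j)%:P + 'X * (i == j)%:R%:P)).
have pE t : p.[t] = \det ((1 - t) *: M + t *: 1%:M).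
  rewrite -horner_evalE -det_map_mx; congr (\det _).
  by apply/matrixP => i j; rewrite !mxE /= horner_evalE !hornerE.
have [||t /andP[t0 t1]] := @poly_ivt R p 0 1; first exact: ler01.
  rewrite !pE subr0 subrr !scale0r !scale1r addr0 add0r dM det1; exact: ler01.
rewrite /root pE; apply/negP; rewrite -unitfE -unitmxE; apply: posdef_unitmx.
have [->|tn0] := eqVneq t 0; first by rewrite subr0 scale0r scale1r addr0.
have [->|tn1] := eqVneq t 1.
  by rewrite subrr scale0r scale1r add0r; exact: posdef1.
apply: posdefD; apply: posdefZ => //; last exact: posdef1.
  by rewrite subr_gt0 lt_neqAle tn1.
by rewrite lt_neqAle eq_sym tn0.
Qed.

(** M^-1 e_k represents the k-th coordinate for the form of M, which turns
    Cauchy-Schwarz into bounds on coordinates. *)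
Lemma bform_invmx_delta M x k : posdefmx M ->
  bform M x (invmx M *m delta_mx k 0) = x k 0.
Proof.
move=> hM; rewrite bformE mulKVmx ?posdef_unitmx // (bigD1 k) //= big1.
  by rewrite mxE !eqxx mulr1 addr0.
by move=> i ik; rewrite mxE (negPf ik) mulr0.
Qed.

(** It shows that the ellipsoid is bounded and, at a basis vector, compares the
    diagonals of M and M^-1. *)
Lemma coord_sqr_le M x k : posdefmx M ->
  x k 0 ^+ 2 <= bform M x x * invmx M k k.
Proof.
move=> hM; have := bform_CauchySchwarz _ x (invmx M *m delta_mx k 0) hM.
by rewrite !bform_invmx_delta // -colE mxE.
Qed.

Lemma inv_diag_le M k : posdefmx M -> (M k k)^-1 <= invmx M k k.
Proof.
move=> hM; have := coord_sqr_le _ (delta_mx k 0) k hM.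
rewrite mxE !eqxx expr1n bform_deltakk => le1.
by rewrite -[leLHS]mulr1 ler_pdivrMl ?posdef_diag_gt0.
Qed.

(** Factoring diag x out of the Jacobian matrix leaves M + diag (1 / x^2), a
    positive definite matrix, and only squares of the 1 / x_k in front. *)
Lemma weight_gt0 M x : posdefmx M -> inverse_eigenvector M x ->
  0 < weight M x.
Proof.
move=> hM hx.
have x0 k := inverse_eigenvector_neq0 k hx.
have sq0 k : 0 < (x k 0)^-1 ^+ 2 by rewrite exprn_even_gt0 //= invr_eq0 x0.
pose D := diag_mx (\row_k (x k 0)^-1 ^+ 2) + M.
have D0 : 0 < \det D.
  by apply/posdef_det_gt0/posdefD => //; apply: posdef_diag_mx => k; rewrite mxE.
have -> : weight M x = (\prod_k (x k 0)^-1 ^+ 2) / \det D.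
  rewrite /weight; have -> : crossmx M x x = diag_mx x^T *m D.
    rewrite mulmxDr; congr (_ + _); apply/matrixP => i j.
    rewrite mul_diag_mx !mxE; case: eqP => _; rewrite ?mulr0n ?mulr0 // !mulr1n.
    by rewrite expr2 mulrA divff // mul1r.
  rewrite det_mulmx det_diag invfM mulrA -prodfV -big_split /=.
  by congr (_ / _); apply: eq_bigr => k _; rewrite mxE expr2.
by rewrite divr_gt0 // prodr_gt0.
Qed.

Lemma det_crossmx_neq0 M x : posdefmx M -> inverse_eigenvector M x ->
  \det (crossmx M x x) != 0.
Proof.
move=> hM /(weight_gt0 _ _ hM); apply: contraTneq => J0.
by rewrite /weight J0 invr0 mulr0 ltxx.
Qed.

(** * An inverse eigenvector in every orthant *)

Lemma deriv_at_min (p : {poly R}) :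
  (forall s, -1 < s < 1 -> p.[0] <= p.[s]) -> p^`().[0] = 0.
Proof.
move=> pmin.
have : is_derive (0 : R) (1 : R) (horner p) 0.
  apply: (@derive1_at_min _ _ (-1) 1) => [|t _||t]; rewrite ?in_itv /=.
  - exact: le_trans (lerN10 R) ler01.
  - exact: derivable_horner.
  - by rewrite ltrN10 ltr01.
  - exact: pmin.
move=> ?; rewrite derivE derive1E; exact: derive_val.
Qed.

(** The difference of the two sides vanishes at s = 0, its minimum, so they have
    the same derivative there: 2 m ^ m on the left, 2 a m ^ m on the right. *)
Lemma quadratic_power_tangent {m : nat} {a b : R} : (0 < m)%N ->
  (forall s, -1 < s < 1 ->
     m%:R ^+ m * (1 + s) ^+ 2 <= (m%:R + 2 * a * s + b * s ^+ 2) ^+ m) ->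
  a = 1.
Proof.
move=> m0 le.
pose p : {poly R} := (m%:R%:P + (2 * a) *: 'X + b *: 'X^2) ^+ m
                     - m%:R ^+ m *: (1 + 'X) ^+ 2.
have pE s : p.[s] = (m%:R + 2 * a * s + b * s ^+ 2) ^+ m - m%:R ^+ m * (1 + s) ^+ 2.
  by rewrite /p !(hornerD, hornerN, hornerZ, horner_exp, hornerC, hornerX, hornerXn).
have : p^`().[0] = 0.
  apply: deriv_at_min => s /le les.
  by rewrite !pE mulr0 expr0n !addr0 mulr0 addr0 expr1n mulr1 subrr subr_ge0.
rewrite /p !(derivD, derivN, derivZ, deriv_exp, derivC, derivX, derivXn).
rewrite !(hornerD, hornerN, hornerZ, horner_exp, hornerC, hornerX, hornerXn,
          hornerM, hornerMn).
have mm : m%:R ^+ m = m%:R ^+ m.-1 * m%:R :> R by rewrite -exprSr prednK.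
rewrite /= !expr1 expr0n !(mulr0, addr0) -mulr_natr mm.
set c : R := m%:R ^+ _; set d : R := m%:R => e.
have cd0 : c * d != 0 by rewrite -mm expf_neq0 // pnatr_eq0 -lt0n.
apply/eqP; rewrite -subr_eq0 -(mulrI_eq0 _ (mulfI cd0)).
have -> : c * d * (a - 1) = 2^-1 * 0 by rewrite -e; field.
by rewrite mulr0.
Qed.

Lemma bform_continuous M : continuous (fun v : 'rV[R]_n => bform M v^T v^T).
Proof.
have cM i : continuous (fun v : 'rV[R]_n => v 0 i) by exact: coord_continuous.
have -> : (fun v : 'rV[R]_n => bform M v^T v^T) =
          (fun v => \sum_i v 0 i * \sum_j M i j * v 0 j).
  apply/funext => v; rewrite bformE; apply: eq_bigr => i _; rewrite !mxE.
  by congr (_ * _); apply: eq_bigr => j _; rewrite mxE.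
apply: continuous_big => [|i _]; first exact: add_continuous.
move=> v; apply: continuousM; first exact: cM.
apply: (@continuous_big _ _ _ 0 xpredT) => [|j _]; first exact: add_continuous.
by move=> w; apply: continuousM; [exact: cst_continuous|exact: cM].
Qed.

Lemma coord_prod_maximum M (eps : 'I_n -> R) (u : 'cV[R]_n) : posdefmx M ->
  ellipsoid M u -> (forall j, 0 <= eps j * u j 0) ->
  exists x : 'cV[R]_n, [/\ ellipsoid M x, forall j, 0 <= eps j * x j 0 &
    forall v : 'cV[R]_n, ellipsoid M v -> (forall j, 0 <= eps j * v j 0) ->
    \prod_j (eps j * v j 0) <= \prod_j (eps j * x j 0)].
Proof.
move=> hM Eu u0.
pose K : set 'rV[R]_n :=
  ((fun v => bform M v^T v^T) @^-1` [set n%:R] `&`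
   \bigcap_j ((fun v : 'rV[R]_n => eps j * v 0 j) @^-1` [set t | 0 <= t]))%classic.
have KE (v : 'cV[R]_n) : (K v^T) <-> ellipsoid M v /\ forall j, 0 <= eps j * v j 0.
  rewrite /K /ellipsoid /bform /= !trmxK; split=> -[-> v0]; split=> // j.
    by have := v0 j I; rewrite /= mxE.
  by move=> _ /=; rewrite mxE.
have ec j : continuous (fun v : 'rV[R]_n => eps j * v 0 j).
  by move=> v; apply: continuousM; [exact: cst_continuous|exact: coord_continuous].
have Kcl : closed K.
  apply: closedI.
    by apply: preimage_closed => [v _|]; [exact: bform_continuous|exact: closed_eq].
  apply: closed_bigI => j _.
  by apply: preimage_closed => [v _|]; [exact: ec|exact: closed_ge].
have Kco : compact K.
  (* t ^+ 2 <= c implies `|t| <= c + 1, which spares a square root. *)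
  pose b j := n%:R * invmx M j j + 1.
  apply: (subclosed_compact Kcl).
    apply: (@rV_compact _ _ (fun j => `[- b j, b j]%classic)) => j.
    exact: segment_compact.
  move=> v [Ev _] j; have {}Ev : bform M v^T v^T = n%:R := Ev.
  have := coord_sqr_le M v^T j hM; rewrite Ev mxE /= in_itv /= => le.
  rewrite -ler_norml /b; rewrite -real_normK ?num_real // in le.
  by have := sqr_ge0 (`|v 0 j| - 1); have := sqr_ge0 `|v 0 j|; nra.
have K0 : (K !=set0)%classic by exists u^T; apply/KE.
pose f (v : 'rV[R]_n) := \prod_j (eps j * v 0 j).
have fc : {within K, continuous f}.
  apply: continuous_subspaceT; apply: continuous_big => [|j _]; last exact: ec.
  exact: mul_continuous.
have [x /set_mem Kx xmax] := compact_EVT_max K0 Kco fc.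
have [Ex x0] : ellipsoid M x^T /\ forall j, 0 <= eps j * x^T j 0.
  by apply/KE; rewrite trmxK.
exists x^T; split=> // v Ev v0.
have fE (w : 'rV[R]_n) : f w = \prod_j (eps j * w^T j 0).
  by apply: eq_bigr => j _; rewrite mxE.
by rewrite -fE -[v]trmxK -fE; apply/xmax/mem_set/KE.
Qed.

(** Take a maximizer x of the product on the part of the ellipsoid in the orthant
    of u; its coordinates do not vanish because those of u do not. Moving x along
    the k-th axis and rescaling to the ellipsoid cannot increase the product,
    and the first-order condition is x_k (M x)_k = 1. *)
Lemma exists_inverse_eigenvector M (eps : 'I_n -> R) (u : 'cV[R]_n) :
  posdefmx M -> ellipsoid M u -> (forall j, 0 < eps j * u j 0) ->
  exists x : 'cV[R]_n, [/\ inverse_eigenvector M x, forall j, 0 < eps j * x j 0 &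
    \prod_j (eps j * u j 0) <= \prod_j (eps j * x j 0)].
Proof.
move=> hM Eu u0.
have [x [Ex x0' xmax]] := coord_prod_maximum _ eps _ hM Eu (fun j => ltW (u0 j)).
have P0 : 0 < \prod_j (eps j * x j 0).
  apply: lt_le_trans (xmax _ Eu _) => [|j]; last exact/ltW.
  by apply: prodr_gt0 => j _.
have x0 j : 0 < eps j * x j 0.
  rewrite lt_neqAle x0' andbT eq_sym; apply: contraTneq P0 => xj0.
  by rewrite (bigD1 j) //= xj0 mul0r ltxx.
exists x; split=> //; last by apply: xmax => // j; apply/ltW.
move=> k.
have n0 : (0 < n)%N by apply: leq_ltn_trans (ltn_ord k).
have nR : 0 < n%:R :> R by rewrite ltr0n.
(* The step is proportional to x_k: it multiplies that coordinate by 1 + s. *)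
pose v s := x + (s * x k 0) *: delta_mx k 0 : 'cV[R]_n.
pose a := x k 0 * (M *m x) k 0.
pose b := x k 0 ^+ 2 * M k k.
have vE s j : v s j 0 = x j 0 * (if j == k then 1 + s else 1).
  rewrite !mxE; case: eqP => [->|_]; rewrite /= ?mulr1 ?mulr0 ?addr0 //.
  by rewrite mulrDr mulr1 mulrC.
have qv s : bform M (v s) (v s) = n%:R + 2 * a * s + b * s ^+ 2.
  rewrite {2}/v bformDr bformZr !(bformC _ (v s)) // /v !bformDr !bformZr.
  rewrite (bformC _ x (delta_mx k 0)) // !bform_delta -colE [col _ _ _ _]mxE.
  have -> : bform M x x = n%:R := Ex.
  by rewrite /a /b; ring.
have sqr_bound s : -1 < s < 1 ->
    n%:R ^+ n * (1 + s) ^+ 2 <= (n%:R + 2 * a * s + b * s ^+ 2) ^+ n.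
  move=> s1; rewrite -qv.
  have v0 j : 0 < eps j * v s j 0.
    by rewrite vE mulrA mulr_gt0 //; case: ifP => _; lra.
  have Q0 : 0 < bform M (v s) (v s).
    apply: bform_gt0 => //; apply/eqP => vs0.
    by have := v0 k; rewrite vs0 mxE mulr0 ltxx.
  set Q := bform M (v s) (v s) in Q0 *.
  (* The factor that brings v s back to the ellipsoid. *)
  pose l := Num.sqrt (n%:R / Q).
  have l2 : l ^+ 2 = n%:R / Q by rewrite sqr_sqrtr // divr_ge0 // ltW.
  have l0 : 0 <= l by exact: sqrtr_ge0.
  have Elv : ellipsoid M (l *: v s).
    rewrite /ellipsoid /= -/(bform M _ _) bformZr (bformC _ (l *: _)) // bformZr.
    by rewrite mulrA -expr2 l2 mulfVK // gt_eqF.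
  have lv0 j : 0 <= eps j * (l *: v s) j 0.
    by rewrite mxE mulrCA mulr_ge0 // ltW.
  have := xmax _ Elv lv0.
  have -> : \prod_j (eps j * (l *: v s) j 0) =
            l ^+ n * (1 + s) * \prod_j (eps j * x j 0).
    have -> : l ^+ n = \prod_(j < n) l by rewrite prodr_const card_ord.
    have -> : 1 + s = \prod_(j < n) (if j == k then 1 + s else 1).
      by rewrite -big_mkcond big_pred1_eq.
    rewrite -!big_split /=; apply: eq_bigr => j _; rewrite mxE vE.
    by rewrite mulrCA -[RHS]mulrA; congr (_ * _); rewrite mulrA mulrC.
  rewrite -[leRHS]mul1r ler_pM2r // => ls1.
  have : (l ^+ n * (1 + s)) ^+ 2 <= 1.
    by rewrite exprn_ile1 // mulr_ge0 ?exprn_ge0 //; lra.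
  rewrite exprMn exprAC l2 expr_div_n mulrAC ler_pdivrMr ?exprn_gt0 //.
  by rewrite mul1r.
exact: quadratic_power_tangent n0 sqr_bound.
Qed.

End PosDef.

(** * The averaging argument *)

(** AM-GM with its equality case. *)
Lemma sum_ge_of_prod_ge1 {R : realType} {n : nat} (y : 'I_n -> R) : (0 < n)%N ->
  (forall j, 0 <= y j) -> 1 <= \prod_j y j ->
  n%:R <= \sum_j y j /\ (\sum_j y j = n%:R -> forall j, y j = 1).
Proof.
move=> n0 y0 P1; have nR : 0 < n%:R :> R by rewrite ltr0n.
have := @leif_AGM R _ 'I_n y (fun j _ => y0 j).
rewrite card_ord; set mu := (\sum_(_ in _) _) / _ => AGM.
have Smu : \sum_j y j = mu * n%:R by rewrite mulfVK ?gt_eqF.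
have mu0 : 0 <= mu by rewrite divr_ge0 ?sumr_ge0 // ltW.
split=> [|Sn j].
  rewrite Smu -[leLHS]mul1r ler_pM2r // -(expr_ge1 n0 mu0).
  exact: le_trans P1 AGM.1.
have mu1 : mu = 1 by apply: (mulIf (lt0r_neq0 nR)); rewrite -Smu Sn mul1r.
have : [forall i in 'I_n, forall j in 'I_n, y i == y j].
  by rewrite -AGM.2 eq_le AGM.1 mu1 expr1n.
move=> /forall_inP/(_ j isT)/forall_inP yj.
apply: (mulIf (lt0r_neq0 nR)); rewrite mul1r -[RHS]Sn.
rewrite (eq_bigr (fun=> y j)) => [|i _]; last by rewrite (eqP (yj i isT)).
by rewrite sumr_const card_ord mulr_natr.
Qed.

Definition orthant_sign {R : realType} {n} (s : {set 'I_n}) : 'cV[R]_n :=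
  \col_j (-1) ^+ (j \in s).

(** The sign vectors span: 2 e_k is the all-ones vector minus the one with its
    k-th sign flipped. *)
Lemma mx1_of_orthant_sign {R : realType} {n} (M : 'M[R]_n) :
  (forall s, M *m orthant_sign s = orthant_sign s) -> M = 1%:M.
Proof.
move=> fixM; apply: trmx_inj; apply/row_matrixP => k; rewrite !rowE.
apply: trmx_inj; rewrite !trmx_mul !trmxK mul1mx trmx_delta.
have -> : delta_mx k 0 =
    2^-1 *: (orthant_sign finset.set0 - orthant_sign [set k]%SET) :> 'cV[R]_n.
  apply/colP => j; rewrite !mxE !inE eqxx andbT.
  by case: eqP => _ /=; rewrite ?expr0 ?expr1; field.
by rewrite -scalemxAr mulmxBr !fixM.
Qed.

(** The subset s holds the negative coordinates of the orthant. The point where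
    the ellipsoid meets the branch of that orthant has |p| = 1, so the maximizer
    there has |p| >= 1. *)
Lemma critical_points {R : realType} {n : nat} {M : 'M[R]_n} : posdefmx M ->
  meets_every_branch (ellipsoid M) ->
  exists x : {set 'I_n} -> 'cV[R]_n, forall s,
    [/\ inverse_eigenvector M (x s), forall j, 0 < (-1) ^+ (j \in s) * x s j 0 &
        1 <= \prod_j x s j 0 ^+ 2].
Proof.
move=> hM /meets_every_branchP hE.
pose eps (s : {set 'I_n}) j : R := (-1) ^+ (j \in s).
have prod_abs s (v : 'cV[R]_n) : (forall j, 0 < eps s j * v j 0) ->
    \prod_j (eps s j * v j 0) = `|coord_prod v|.
  move=> v0; rewrite /coord_prod normr_prod; apply: eq_bigr => j _.
  by rewrite -[LHS]gtr0_norm // normrM normrX normrN1 expr1n mul1r.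
suff /choice[x xP] : forall s, exists v : 'cV[R]_n,
    [/\ inverse_eigenvector M v, forall j, 0 < eps s j * v j 0 &
        1 <= \prod_j v j 0 ^+ 2] by exists x.
move=> s.
have epsP j : eps s j = 1 \/ eps s j = -1.
  by rewrite /eps; case: (j \in s); [right|left].
have [u [Eu u0 u1]] := hE _ epsP.
have [x [hx x0 xmax]] := exists_inverse_eigenvector _ _ _ hM Eu u0.
exists x; split=> //.
move: xmax; rewrite !prod_abs // u1 => x1.
by rewrite prodrXl -real_normK ?num_real // expr_ge1.
Qed.

Theorem corollary8 (R : realType) (n : nat) (M : 'M[R]_n) (hn : (2 <= n)%N)
    (hM : posdefmx M) (hE : meets_every_branch (ellipsoid M)) :
  [/\ n%:R <= \sum_(k < n) (M k k)^-1,
      n%:R <= \tr (invmx M),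
      (\sum_(k < n) (M k k)^-1 = n%:R) <-> (M = 1%:M)
    & (\tr (invmx M) = n%:R) <-> (M = 1%:M)].
Proof.
have n0 : (0 < n)%N by apply: leq_trans hn.
have [x xP] := critical_points hM hE.
have hx s : inverse_eigenvector M (x s) by have [] := xP s.
have xI : injective x.
  move=> s t st; apply/setP => j.
  have [_ /(_ j) + _] := xP s; have [_ /(_ j) + _] := xP t; rewrite st.
  by case: (j \in s); case: (j \in t) => //=; rewrite expr0 expr1; lra.
have J0 s := det_crossmx_neq0 M (x s) hM (hx s).
have w0 s := weight_gt0 M (x s) hM (hx s).
pose N s := \sum_k x s k 0 ^+ 2.
have N_AGM s : n%:R <= N s /\ (N s = n%:R -> forall j, x s j 0 ^+ 2 = 1).
  by apply: sum_ge_of_prod_ge1 => // [j|]; [exact: sqr_ge0 | have [] := xP s].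
(* The sums of squares N s, averaged with the weights, give the sum of the 1 / m_kk. *)
have average : \sum_k (M k k)^-1 - n%:R = \sum_s weight M (x s) * (N s - n%:R).
  under [RHS]eq_bigr do rewrite mulrBr mulr_sumr.
  rewrite sumrB -mulr_suml sum_weight // mul1r exchange_big /=.
  congr (_ - _); apply: eq_bigr => k _.
  by rewrite sum_weight_sqr // gt_eqF // posdef_diag_gt0.
have term_ge0 s : 0 <= weight M (x s) * (N s - n%:R).
  by rewrite mulr_ge0 ?(ltW (w0 s)) // subr_ge0; have [] := N_AGM s.
have le_diag : n%:R <= \sum_k (M k k)^-1.
  by rewrite -subr_ge0 average sumr_ge0.
have le_tr : \sum_k (M k k)^-1 <= \tr (invmx M).
  by apply: ler_sum => k _; exact: inv_diag_le.
have eq_diag : \sum_k (M k k)^-1 = n%:R -> M = 1%:M.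
  move=> Sn; apply: mx1_of_orthant_sign => s.
  have Ns : N s = n%:R.
    move/eqP: average; rewrite Sn subrr eq_sym psumr_eq0 //.
    move=> /allP/(_ s (mem_index_enum _)).
    by rewrite mulf_eq0 (gt_eqF (w0 s)) subr_eq0 => /eqP.
  have xx1 j : x s j 0 ^+ 2 = 1 by have [_ ->] := N_AGM s.
  have -> : orthant_sign s = x s.
    apply/colP => j; rewrite mxE; have [_ /(_ j) + _] := xP s.
    have /eqP := xx1 j; rewrite sqrf_eq1.
    by case: (j \in s) => /orP[] /eqP ->; rewrite /= ?expr0 ?expr1; lra.
  apply/colP => j; rewrite (inverse_eigenvectorE _ (hx s)).
  apply: (mulfI (inverse_eigenvector_neq0 j (hx s))).
  by rewrite divff ?(inverse_eigenvector_neq0 j (hx s)) // -expr2 xx1.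
have tr1 : M = 1%:M -> \tr (invmx M) = n%:R by move=> ->; rewrite invmx1 mxtrace1.
split=> //; first exact: le_trans le_diag le_tr.
- split=> // ->; rewrite (eq_bigr (fun=> 1)) => [|k _]; last by rewrite mxE eqxx invr1.
  by rewrite sumr_const card_ord.
- by split=> // tn; apply: eq_diag; apply/eqP; rewrite eq_le le_diag -tn le_tr.
Qed.
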